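(* Let $\mathcal{A}\in T_{m,n}$ be a symmetric tensor and let $\mathbf{q}\in\mathbb{R}^n$ be nonzero. Consider the problem $\mathrm{NCP}(\mathbf{q},\mathcal{A})$: find $\mathbf{x}\in\mathbb{R}^n_+$ such that $\mathcal{A}\mathbf{x}^{m-1}+\mathbf{q}\in\mathbb{R}^n_+$ and $\mathcal{A}\mathbf{x}^m+\mathbf{q}^\top\mathbf{x}=0$. The following hold. (a) If $\mathcal{A}$ is diagonalizable and positive definite, then $\mathrm{NCP}(\mathbf{q},\mathcal{A})$ has a unique solution. (b) If $\mathcal{A}$ is positive definite, then $\mathrm{NCP}(\mathbf{q},\mathcal{A})$ has a nonempty, compact solution set. (c) If $\mathcal{A}$ is strictly copositive with respect to $\mathbb{R}^n_+$, then $\mathrm{NCP}(\mathbf{q},\mathcal{A})$ has a nonempty, compact solution set.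
   Context: Throughout, $m,n\ge 2$ are integers and $m$ is even. $T_{m,n}$ is the set of real tensors of order $m$ and dimension $n$, $\mathcal{A}=(\mathcal{A}_{i_1\dots i_m})$ with $i_1,\dots,i_m\in\{1,\dots,n\}$. $\mathcal{A}$ is symmetric if its entries are invariant under every permutation of the indices. $\mathbb{R}^n_+$ is the nonnegative orthant. For $\mathbf{x}\in\mathbb{R}^n$: $\mathcal{A}\mathbf{x}^m=\sum_{i_1,\dots,i_m}\mathcal{A}_{i_1\dots i_m}x_{i_1}\cdots x_{i_m}$, and $\mathcal{A}\mathbf{x}^{m-1}\in\mathbb{R}^n$ is the vector with $i$-th entry $\sum_{i_2,\dots,i_m}\mathcal{A}_{i i_2\dots i_m}x_{i_2}\cdots x_{i_m}$. A symmetric tensor $\mathcal{A}$ is positive definite if $\mathcal{A}\mathbf{x}^m>0$ for all nonzero $\mathbf{x}\in\mathbb{R}^n$, and strictly copositive (with respect to $\mathbb{R}^n_+$) if $\mathcal{A}\mathbf{x}^m>0$ for all nonzero $\mathbf{x}\in\mathbb{R}^n_+$. For $\mathcal{C}\in T_{m,n}$ and $B\in\mathbb{R}^{n\times n}$, the mode-$k$ product $\mathcal{C}\times_k B\in T_{m,n}$ is given by $(\mathcal{C}\times_k B)_{i_1\dots i_{k-1}ji_{k+1}\dots i_m}=\sum_{i_k=1}^n\mathcal{C}_{i_1\dots i_m}b_{ji_k}$. A tensor is diagonal if all its off-diagonal entries (those with indices not all equal) are zero. A symmetric tensor $\mathcal{A}$ is diagonalizable if $\mathcal{A}=\mathcal{D}\times_1B\times_2B\cdots\times_mB$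 for some diagonal tensor $\mathcal{D}\in T_{m,n}$ and some $B\in\mathbb{R}^{n\times n}$ with $\det(B)\neq 0$. *)

(* Defs.v *)
From HB Require Import structures.
From mathcomp Require Import all_boot all_order all_algebra all_fingroup.
From mathcomp Require Import all_classical all_reals all_analysis.

Set Implicit Arguments.
Unset Strict Implicit.
Unset Printing Implicit Defensive.

Import Order.TTheory GRing.Theory Num.Theory.
Import numFieldNormedType.Exports.

Local Open Scope classical_set_scope.
Local Open Scope ring_scope.

(* Multi-indices (i_1, ..., i_m) are finite functions 'I_m -> 'I_n, numbered
   from 0, and vectors of R^n are row vectors. *)
Definition multi_index (m n : nat) := {ffun 'I_m -> 'I_n}.

Definition tensor (R : realType) (m n : nat) := {ffun multi_index m n -> R}.

Definition symmetric_tensor (R : realType) (m n : nat) (A : tensor R m n) :=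
  forall (s : {perm 'I_m}) (f : multi_index m n),
    A [ffun k => f (s k)] = A f.

Definition orthant (R : realType) (n : nat) : set 'rV[R]_n :=
  [set x | forall i : 'I_n, 0 <= x 0 i].

(* A x^m *)
Definition tensor_form (R : realType) (m n : nat)
    (A : tensor R m n) (x : 'rV[R]_n) : R :=
  \sum_(f : multi_index m n) A f * \prod_(k < m) x 0 (f k).

(* A x^(m-1): the condition on f says that its first index (at position 0)
   is i, so f ranges over the (i, i_2, ..., i_m); meaningful for m > 0. *)
Definition tensor_map (R : realType) (m n : nat)
    (A : tensor R m n) (x : 'rV[R]_n) : 'rV[R]_n :=
  \row_(i < n)
    \sum_(f : multi_index m n | [forall k : 'I_m, (k == 0%N :> nat) ==> (f k == i)])
      A f * \prod_(k < m | k != 0%N :> nat) x 0 (f k).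

Definition positive_definite (R : realType) (m n : nat) (A : tensor R m n) :=
  forall x : 'rV[R]_n, x != 0 -> 0 < tensor_form A x.

Definition strictly_copositive (R : realType) (m n : nat) (A : tensor R m n) :=
  forall x : 'rV[R]_n, orthant x -> x != 0 -> 0 < tensor_form A x.

Definition mode_product (R : realType) (m n : nat)
    (C : tensor R m n) (k : 'I_m) (B : 'M[R]_n) : tensor R m n :=
  [ffun f : multi_index m n =>
    \sum_(i < n) C [ffun l => if l == k then i else f l] * B (f k) i].

Definition mode_product_all (R : realType) (m n : nat)
    (D : tensor R m n) (B : 'M[R]_n) : tensor R m n :=
  foldl (fun C k => mode_product C k B) D (enum 'I_m).

Definition diagonal_tensor (R : realType) (m n : nat) (D : tensor R m n) :=
  forall (f : multi_index m n) (k l : 'I_m), f k != f l -> D f = 0.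

Definition diagonalizable_tensor (R : realType) (m n : nat)
    (A : tensor R m n) :=
  exists (D : tensor R m n) (B : 'M[R]_n),
    [/\ diagonal_tensor D, \det B != 0 & A = mode_product_all D B].

Definition ncp_solutions (R : realType) (m n : nat)
    (q : 'rV[R]_n) (A : tensor R m n) : set 'rV[R]_n :=
  [set x | [/\ orthant x, orthant (tensor_map A x + q)
             & tensor_form A x + \sum_(i < n) q 0 i * x 0 i = 0]].

(* Main.v *)
Require Import Defs.
From HB Require Import structures.
From mathcomp Require Import all_boot all_order all_algebra all_fingroup.
From mathcomp Require Import all_classical all_reals all_analysis.

(** The problem is the first-order condition of an optimization problem. Write
    F x = A x^(m-1) + q. By symmetry of A, the gradient of
    g x = A x^m + m (q . x) is m (F x), so a minimizer x of g over the orthant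
    satisfies v . F x >= 0 for every feasible direction v at x
    ([variational_inequality]); the directions e_i, x and - x then say exactly
    that x solves NCP(q, A) ([minimizer_ncp_solution]).

    Strict copositivity gives a > 0 with A x^m >= a |x|^m on the orthant
    ([copositive_coercive]), by homogeneity and compactness of the part of the
    unit sphere inside the orthant. As m >= 2, the power |x|^m outgrows every
    linear term, so that the part of the orthant where A x^m + c . x <= 0 is
    compact ([compact_sublevel]). With c = m q it yields a minimizer of g, and
    with c = q it contains the solution set, which is closed. This proves (c),
    and (b) is a special case.

    For uniqueness in (a), view A x^m as the diagonal of a multilinear form.
    If A is obtained from a diagonal tensor with entries d_j by the matrix B,
    then v . A x^(m-1) = sum_j d_j (v B)_j (x B)_j^(m-1), with all d_j > 0
    because A is positive definite. Since m - 1 is odd, x |-> A x^(m-1) is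
    strictly monotone ([diagonalizable_strict_monotone]); but two solutions x
    and y satisfy (x - y) . (F x - F y) = - x . F y - y . F x <= 0, so they are
    equal. *)

Set Implicit Arguments.
Unset Strict Implicit.
Unset Printing Implicit Defensive.

Import Order.TTheory GRing.Theory Num.Theory.
Import numFieldNormedType.Exports.

Local Open Scope classical_set_scope.
Local Open Scope ring_scope.

(** * The multilinear form of a tensor *)

(** The Euclidean inner product of row vectors. *)
Definition dot (R : realType) (n : nat) (u v : 'rV[R]_n) : R :=
  \sum_(i < n) u 0 i * v 0 i.

(** The m-linear form of A, evaluated at the family X of its m arguments;
    [tensor_form A x] is by definition its value at the constant family x. *)
Definition multilinear_form (R : realType) (m n : nat) (A : tensor R m n)
    (X : 'I_m -> 'rV[R]_n) : R :=
  \sum_(f : multi_index m n) A f * \prod_(k < m) X k 0 (f k).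

Section MultilinearForm.
Context (R : realType) (n : nat).
Implicit Types (m : nat) (u v x y : 'rV[R]_n).

Lemma dotC u v : dot u v = dot v u.
Proof. by apply: eq_bigr => i _; rewrite mulrC. Qed.

Lemma dotDr u v w : dot u (v + w) = dot u v + dot u w.
Proof. by rewrite -big_split; apply: eq_bigr => i _; rewrite mxE mulrDr. Qed.

Lemma dotZr a u v : dot u (a *: v) = a * dot u v.
Proof. by rewrite mulr_sumr; apply: eq_bigr => i _; rewrite mxE mulrCA. Qed.

Lemma dotNr u v : dot u (- v) = - dot u v.
Proof. by rewrite -scaleN1r dotZr mulN1r. Qed.

Lemma dot_delta i v : dot (delta_mx 0 i) v = v 0 i.
Proof.
rewrite /dot (bigD1 i)//= mxE !eqxx mul1r big1 ?addr0// => j /negPf ji.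
by rewrite mxE ji mul0r.
Qed.

Lemma dot_ge0 u v : orthant u -> orthant v -> 0 <= dot u v.
Proof. by move=> u0 v0; apply: sumr_ge0 => i _; apply: mulr_ge0. Qed.

Lemma eq_multilinear_form m (A : tensor R m n) (X Y : 'I_m -> 'rV[R]_n) :
  X =1 Y -> multilinear_form A X = multilinear_form A Y.
Proof. by move=> XY; congr (multilinear_form A _); apply/funext. Qed.

Lemma multilinear_form_slot0 m (A : tensor R m.+1 n) v x :
  multilinear_form A (fun k => if k == ord0 then v else x)
  = dot v (tensor_map A x).
Proof.
rewrite /multilinear_form.
rewrite (partition_big (fun f : multi_index m.+1 n => f ord0) predT)//=.
apply: eq_bigr => i _; rewrite mxE mulr_sumr; apply: eq_big => [f|f /eqP fi].
  apply/eqP/forallP => [<- k|/(_ ord0)/eqP//].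
  by apply/implyP => k0; apply/eqP; congr (f _); exact/val_inj/eqP.
rewrite mulrCA (bigD1 ord0)//= fi; congr (_ * (_ * _)).
by apply: eq_bigr => k /negPf ->.
Qed.

Lemma dot_tensor_map m (A : tensor R m.+1 n) x :
  dot x (tensor_map A x) = tensor_form A x.
Proof.
by rewrite -multilinear_form_slot0; apply: eq_multilinear_form => k; case: ifP.
Qed.

(** For a symmetric tensor the position of the exceptional argument v does not
    matter. *)
Lemma multilinear_form_slot m (A : tensor R m.+1 n) (k0 : 'I_m.+1) v x :
  symmetric_tensor A ->
  multilinear_form A (fun k => if k == k0 then v else x)
  = dot v (tensor_map A x).
Proof.
move=> symA; rewrite -multilinear_form_slot0.
pose s := tperm ord0 k0.
pose h (f : multi_index m.+1 n) : multi_index m.+1 n := [ffun k => f (s k)].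
have hK : involutive h by move=> f; apply/ffunP => k; rewrite !ffunE tpermK.
rewrite /multilinear_form (reindex_inj (inv_inj hK))/=.
apply: eq_bigr => f _; rewrite symA; congr (_ * _).
rewrite (reindex_inj (@perm_inj _ s))/=; apply: eq_bigr => k _.
by rewrite ffunE tpermK -(inj_eq (@perm_inj _ s)) tpermK tpermR.
Qed.

(** A mode-k product by B amounts to applying B, on the right since vectors are
    rows, to the k-th argument of the form. *)
Lemma multilinear_form_mode_product m (C : tensor R m n) (k : 'I_m)
    (B : 'M[R]_n) (X : 'I_m -> 'rV[R]_n) :
  multilinear_form (mode_product C k B) X
  = multilinear_form C (fun l => if l == k then X l *m B else X l).
Proof.
pose upd (f : multi_index m n) i : multi_index m n :=
  [ffun l => if l == k then i else f l].
(* exchanging the index i with the k-th component of f is an involution *)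
pose h (p : multi_index m n * 'I_n) := (upd p.1 p.2, p.1 k).
have hK : involutive h.
  move=> [f i]; rewrite /h /upd /= ffunE eqxx; congr (_, _).
  by apply/ffunP => l; rewrite !ffunE; case: eqP => [->|].
transitivity (\sum_(p : multi_index m n * 'I_n)
  C (upd p.1 p.2) * B (p.1 k) p.2 * \prod_(l < m) X l 0 (p.1 l)).
  rewrite -(pair_bigA _ (fun f i => C (upd f i) * B (f k) i
             * \prod_(l < m) X l 0 (f l)))/=.
  by apply: eq_bigr => f _; rewrite ffunE mulr_suml.
rewrite (reindex_inj (inv_inj hK))/=.
rewrite -(pair_bigA _ (fun f i => C (upd (upd f i) (f k)) * B (upd f i k) (f k)
             * \prod_(l < m) X l 0 (upd f i l)))/=.
apply: eq_bigr => f _.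
rewrite [X in _ = _ * X](bigD1 k)//= eqxx mxE mulr_suml mulr_sumr.
apply: eq_bigr => i _.
have -> : upd (upd f i) (f k) = f.
  by apply/ffunP => l; rewrite !ffunE; case: eqP => [->|].
rewrite (bigD1 k)//= ffunE eqxx -mulrA; congr (_ * _).
rewrite mulrA [B _ _ * _]mulrC; congr (_ * _).
by apply: eq_bigr => l /negPf lk; rewrite ffunE lk.
Qed.

Lemma multilinear_form_mode_product_all m (D : tensor R m n) (B : 'M[R]_n)
    (X : 'I_m -> 'rV[R]_n) :
  multilinear_form (mode_product_all D B) X
  = multilinear_form D (fun k => X k *m B).
Proof.
(* for a partial list of modes, B acts on the arguments in that list *)
suff foldlE (s : seq 'I_m) (C : tensor R m n) : uniq s ->
    multilinear_form (foldl (fun C k => mode_product C k B) C s) X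
    = multilinear_form C (fun k => if k \in s then X k *m B else X k).
  rewrite foldlE ?enum_uniq//; apply: eq_multilinear_form => k.
  by rewrite mem_enum.
elim: s C => [|k s IHs] C //= /andP[ks us].
rewrite IHs// multilinear_form_mode_product; apply: eq_multilinear_form => l.
by rewrite inE; case: (eqVneq l k) => [->|//]; rewrite (negPf ks).
Qed.

Lemma multilinear_form_diagonal m (D : tensor R m.+1 n)
    (X : 'I_m.+1 -> 'rV[R]_n) :
  diagonal_tensor D ->
  multilinear_form D X
  = \sum_(j < n) D [ffun=> j] * \prod_(k < m.+1) X k 0 j.
Proof.
move=> diagD.
rewrite /multilinear_form.
rewrite (partition_big (fun f : multi_index m.+1 n => f ord0) predT)//=.
apply: eq_bigr => j _; rewrite (bigD1 [ffun=> j])/=; last by rewrite ffunE.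
rewrite [X in _ + X]big1 ?addr0.
  by congr (_ * _); apply: eq_bigr => k _; rewrite ffunE.
move=> f /andP[/eqP f0 fj].
have [k fk] : exists k, f k != f ord0.
  apply/existsP; apply: contraNT fj => /existsPn nf.
  by apply/eqP/ffunP => k; rewrite ffunE -f0; apply/eqP/negPn/nf.
by rewrite (diagD f k ord0 fk) mul0r.
Qed.

End MultilinearForm.

(** * First-order condition for a minimizer *)

Lemma deriv_prod (R : comNzRingType) (I : eqType) (r : seq I)
    (F : I -> {poly R}) :
  uniq r ->
  (\prod_(i <- r) F i)^`()
  = \sum_(i <- r) (F i)^`() * \prod_(j <- r | j != i) F j.
Proof.
elim: r => [|i r IHr]; first by rewrite !big_nil derivC.
move=> /= /andP[ir ur]; rewrite !big_cons derivM IHr// eqxx/=.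
congr (_ * _ + _).
  rewrite [RHS]big_seq_cond [LHS]big_seq; apply: eq_bigl => j.
  by rewrite andb_idr// => jr; apply: contraNneq ir => <-.
rewrite mulr_sumr; apply: eq_big_seq => j jr.
have ij : i != j by apply: contraNneq ir => ->.
by rewrite big_cons ij mulrCA.
Qed.

(** If p(0) is the minimum of p on [0, 1], then p'(0) >= 0, because p'(0) is the
    value at 0 of the polynomial (p - p(0)) / X, nonnegative on ]0, 1]. *)
Lemma horner_deriv_ge0 (R : realType) (p : {poly R}) :
  (forall t, 0 < t <= 1 -> p.[0] <= p.[t]) -> 0 <= p^`().[0].
Proof.
move=> p_min.
have /factor_theorem[h ph] : root (p - p.[0]%:P) 0.
  by rewrite /root !hornerE subrr.
have -> : p^`().[0] = h.[0].
  have -> : p = h * ('X - 0%:P) + p.[0]%:P by rewrite -ph subrK.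
  rewrite derivD derivC addr0 derivM derivXsubC mulr1 hornerD hornerM.
  by rewrite hornerXsubC subrr mulr0 add0r.
rewrite leNgt; apply/negP => h0_lt0.
have : \forall t \near (0 : R), h.[t] < 0.
  exact: (cvgr_lt h.[0] (@continuous_horner R h 0) 0 h0_lt0).
move=> /nbhs_ballP[e /= e0 h_lt0].
pose t := Num.min 1 (e / 2).
have t0 : 0 < t by rewrite lt_min ltr01 divr_gt0.
have te : t < e.
  by rewrite gt_min (ltr_pdivrMr _ _ (ltr0n _ 2)) ltr_pMr// ltr1n orbT.
have t1 : 0 < t <= 1 by rewrite t0 ge_min lexx.
have /h_lt0 : ball 0 e t by rewrite /ball/= sub0r normrN gtr0_norm.
apply/negP; rewrite -leNgt -(pmulr_lge0 _ t0).
have := congr1 (horner^~ t) ph; rewrite !hornerE subr0 => <-.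
by rewrite subr_ge0 p_min.
Qed.

Section FirstOrder.
Context (R : realType) (m n : nat).
Implicit Types (A : tensor R m.+1 n) (q v x y : 'rV[R]_n).

(** The polynomial in t whose value at t is the form at x + t v. *)
Definition line_poly A x v : {poly R} :=
  \sum_(f : multi_index m.+1 n)
     (A f)%:P * \prod_(k < m.+1) ((x 0 (f k))%:P + (v 0 (f k))%:P * 'X).

Lemma horner_line_poly A x v t :
  (line_poly A x v).[t] = tensor_form A (x + t *: v).
Proof.
rewrite horner_sum; apply: eq_bigr => f _.
rewrite hornerM hornerC horner_prod; congr (_ * _).
by apply: eq_bigr => k _; rewrite !hornerE !mxE mulrC.
Qed.

(** For A of order m + 1, the gradient of A x^(m+1) is (m + 1) A x^m: each of the
    m + 1 arguments contributes equally to the derivative along v, by symmetry. *)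
Lemma deriv_line_poly A x v :
  symmetric_tensor A ->
  (line_poly A x v)^`().[0] = m.+1%:R * dot v (tensor_map A x).
Proof.
move=> symA.
transitivity (\sum_(k < m.+1)
    multilinear_form A (fun l => if l == k then v else x)); last first.
  under eq_bigr do rewrite multilinear_form_slot//.
  by rewrite sumr_const card_ord mulr_natl.
rewrite exchange_big raddf_sum horner_sum; apply: eq_bigr => f _ /=.
rewrite derivM derivC mul0r add0r deriv_prod ?index_enum_uniq//.
rewrite hornerM hornerC horner_sum -mulr_sumr; congr (_ * _).
apply: eq_bigr => k _; rewrite hornerM horner_prod [RHS](bigD1 k)//= eqxx.
rewrite derivD derivC derivM derivC derivX !hornerE; congr (_ * _).
by apply: eq_bigr => l /negPf ->; rewrite !hornerE.
Qed.

End FirstOrder.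

Section VariationalInequality.
Context (R : realType) (m n : nat) (A : tensor R m.+1 n) (q : 'rV[R]_n).
Hypothesis A_sym : symmetric_tensor A.

(** The first-order condition, along a feasible direction v, for a minimizer over
    the orthant. The factor m + 1 on q offsets the one in the gradient of the
    form, A being of order m + 1. *)
Lemma variational_inequality (x v : 'rV[R]_n) :
  (forall y, orthant y ->
     tensor_form A x + dot (m.+1%:R *: q) x
     <= tensor_form A y + dot (m.+1%:R *: q) y) ->
  (forall t, 0 < t <= 1 -> orthant (x + t *: v)) ->
  0 <= dot v (tensor_map A x + q).
Proof.
move=> x_min xv.
pose c : 'rV[R]_n := m.+1%:R *: q.
pose p := line_poly A x v + ((dot c x)%:P + (dot c v)%:P * 'X).
have pE t : p.[t] = tensor_form A (x + t *: v) + dot c (x + t *: v).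
  rewrite /p !hornerD horner_line_poly hornerM !hornerC hornerX.
  by rewrite dotDr dotZr [t * _]mulrC.
have : 0 <= p^`().[0].
  apply: horner_deriv_ge0 => t t01; rewrite !pE scale0r addr0.
  exact/x_min/xv.
rewrite /p derivD hornerD deriv_line_poly// derivD derivC derivM derivC derivX.
have -> : dot c v = m.+1%:R * dot v q by rewrite dotC dotZr.
by rewrite mul0r add0r mulr1 add0r hornerC -mulrDr -dotDr pmulr_rge0 ?ltr0n.
Qed.

Lemma minimizer_ncp_solution (x : 'rV[R]_n) :
  orthant x ->
  (forall y, orthant y ->
     tensor_form A x + dot (m.+1%:R *: q) x
     <= tensor_form A y + dot (m.+1%:R *: q) y) ->
  ncp_solutions q A x.
Proof.
move=> x0 x_min.
have VI := variational_inequality x_min.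
split=> [||]; [exact: x0|move=> i|].
  rewrite -dot_delta; apply: VI => t /andP[t0 _] j.
  by rewrite !mxE addr_ge0// mulr_ge0 ?ler0n// ltW.
rewrite -/(dot q x) (dotC q) -dot_tensor_map -dotDr.
apply/eqP; rewrite eq_le; apply/andP; split.
  suff : 0 <= dot (- x) (tensor_map A x + q).
    by rewrite dotC dotNr dotC oppr_ge0.
  apply: VI => t /andP[t0 t1] i.
  by rewrite !mxE mulrN -{1}[x 0 i]mul1r -mulrBl mulr_ge0// subr_ge0.
by apply: VI => t /andP[t0 _] i; rewrite !mxE addr_ge0// mulr_ge0// ltW.
Qed.

End VariationalInequality.

(** * Coercivity and compactness *)

Section Continuity.
Context (R : realType) (n : nat).
Implicit Types (m : nat).

Lemma continuous_sumr (T : topologicalType) (I : Type) (r : seq I)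
    (P : pred I) (F : I -> T -> R) :
  (forall i, P i -> continuous (F i)) ->
  continuous (fun x => \sum_(i <- r | P i) F i x).
Proof. by move=> Fc; apply: continuous_big => //; exact: add_continuous. Qed.

Lemma continuous_prodr (T : topologicalType) (I : Type) (r : seq I)
    (P : pred I) (F : I -> T -> R) :
  (forall i, P i -> continuous (F i)) ->
  continuous (fun x => \prod_(i <- r | P i) F i x).
Proof. by move=> Fc; apply: continuous_big => //; exact: mul_continuous. Qed.

Lemma continuous_monomial m (P : pred 'I_m) (a : R) (f : multi_index m n) :
  continuous (fun x : 'rV[R]_n => a * \prod_(k < m | P k) x 0 (f k)).
Proof.
move=> x; apply: continuousM; first exact: cst_continuous.
apply: (@continuous_prodr _ _ _ _ (fun k (x : 'rV[R]_n) => x 0 (f k))) => k _.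
exact: coord_continuous.
Qed.

Lemma continuous_tensor_form m (A : tensor R m n) :
  continuous (tensor_form A : 'rV[R]_n -> R).
Proof.
apply: continuous_sumr => f _.
exact: (@continuous_monomial m xpredT (A f) f).
Qed.

Lemma continuous_tensor_map m (A : tensor R m n) (i : 'I_n) :
  continuous (fun x : 'rV[R]_n => tensor_map A x 0 i).
Proof.
under eq_fun do rewrite mxE.
apply: continuous_sumr => f _.
exact: (@continuous_monomial m (fun k => k != 0%N :> nat) (A f) f).
Qed.

Lemma continuous_dot (c : 'rV[R]_n) : continuous (dot c).
Proof.
apply: continuous_sumr => i _ x.
by apply: continuousM; [exact: cst_continuous|exact: coord_continuous].
Qed.

Lemma continuous_objective m (A : tensor R m n) (c : 'rV[R]_n) :
  continuous (fun x => tensor_form A x + dot c x).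
Proof.
move=> x; apply: continuousD; first exact: continuous_tensor_form.
exact: continuous_dot.
Qed.

Lemma closed_preimage_orthant (g : 'rV[R]_n -> 'rV[R]_n) :
  (forall i, continuous (fun x => g x 0 i)) ->
  closed [set x | orthant (g x)].
Proof.
move=> gc.
rewrite (_ : mkset _ =
    \bigcap_(i in setT) (fun x => g x 0 i) @^-1` [set y | 0 <= y]).
  by apply: closed_bigI => i _; apply: preimage_closed.
by apply/seteqP; split=> x /= xg i; [move=> _|]; exact: xg.
Qed.

Lemma closed_orthant : closed (@orthant R n).
Proof. by apply: closed_preimage_orthant => i; exact: coord_continuous. Qed.

Lemma closed_ncp_solutions m (A : tensor R m n) (q : 'rV[R]_n) :
  closed (ncp_solutions q A).
Proof.
rewrite (_ : ncp_solutions q A = @orthant R n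
    `&` [set x | orthant (tensor_map A x + q)]
    `&` (fun x => tensor_form A x + dot q x) @^-1` [set 0]).
  apply: closedI; first apply: closedI; first exact: closed_orthant.
    apply: closed_preimage_orthant => i.
    under eq_fun do rewrite mxE.
    move=> x; apply: continuousD; first exact: continuous_tensor_map.
    exact: cst_continuous.
  apply: preimage_closed => [x _|]; first exact: continuous_objective.
  exact: closed_eq.
by apply/seteqP; split=> x [] => [? ? ?|[? ?] ?].
Qed.

End Continuity.

Section Coercivity.
Context (R : realType) (m n : nat) (A : tensor R m.+1 n).
Implicit Types (x c : 'rV[R]_n).
Hypothesis A_cop : strictly_copositive A.

Lemma tensor_formZ t x : tensor_form A (t *: x) = t ^+ m.+1 * tensor_form A x.
Proof.
rewrite mulr_sumr; apply: eq_bigr => f _; rewrite mulrCA; congr (_ * _).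
under eq_bigr do rewrite mxE.
by rewrite big_split/= prodr_const card_ord.
Qed.

Lemma tensor_form0 : tensor_form A 0 = 0.
Proof. by rewrite -(scale0r 0) tensor_formZ expr0n mul0r. Qed.

Lemma ler_coord_norm x i : `|x 0 i| <= `|x|.
Proof.
rewrite [leRHS]/Num.norm/= mx_normrE.
exact: (le_bigmax _ (fun ij : 'I_1 * 'I_n => `|x ij.1 ij.2|) (0, i)).
Qed.

Lemma ler_norm_dot c x : `|dot c x| <= (\sum_i `|c 0 i|) * `|x|.
Proof.
apply: le_trans (ler_norm_sum _ _ _) _; rewrite mulr_suml.
by apply: ler_sum => i _; rewrite normrM ler_wpM2l// ler_coord_norm.
Qed.

Lemma orthantZ t x : 0 <= t -> orthant x -> orthant (t *: x).
Proof. by move=> t0 x0 i; rewrite mxE mulr_ge0. Qed.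

Lemma copositive_coercive :
  exists2 a, 0 < a &
    forall x, orthant x -> a * `|x| ^+ m.+1 <= tensor_form A x.
Proof.
pose S := @orthant R n `&` [set x : 'rV[R]_n | `|x| = 1].
have cptS : compact S.
  apply: bounded_closed_compact.
    by exists 1; split=> [|N N1 x [_ /= ->]]; [exact: num_real|exact: ltW].
  apply: closedI; first exact: closed_orthant.
  apply: (@preimage_closed _ _ (fun x : 'rV[R]_n => `|x|) [set 1]).
    by move=> x _; exact: norm_continuous.
  exact: closed_eq.
have [a a0 aS] : exists2 a, 0 < a & forall x, S x -> a <= tensor_form A x.
  have [S0|/nonemptyPn S0] := pselect (S !=set0); last first.
    by exists 1 => // x; rewrite S0.
  have [|x0 /set_mem[x0o x01] x0_min] :=
    EVT_min_rV S0 cptS (f := tensor_form A).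
    by apply: continuous_subspaceT; exact: continuous_tensor_form.
  exists (tensor_form A x0) => [|x Sx]; last exact/x0_min/mem_set.
  by apply: A_cop; rewrite // -normr_eq0 x01 oner_eq0.
exists a => // x xo; have [->|x0] := eqVneq x 0.
  by rewrite normr0 expr0n mulr0 tensor_form0.
have xN0 : `|x| != 0 by rewrite normr_eq0.
have xE : x = `|x| *: (`|x|^-1 *: x) by rewrite scalerA mulfV// scale1r.
rewrite {2}xE tensor_formZ mulrC ler_wpM2l ?exprn_ge0//; apply: aS; split.
  by apply: orthantZ; rewrite ?invr_ge0.
by rewrite /= normrZ normfV normr_id mulVf.
Qed.

(** On this set a |x|^(m+1) <= |c . x|, which bounds |x| because m > 0. *)
Lemma compact_sublevel c :
  (0 < m)%N ->
  compact (@orthant R n `&` [set x | tensor_form A x + dot c x <= 0]).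
Proof.
move=> m0; apply: bounded_closed_compact; last first.
  apply: closedI; first exact: closed_orthant.
  apply: (@preimage_closed _ _ (fun x => tensor_form A x + dot c x)
            [set y | y <= 0]).
    by move=> x _; exact: continuous_objective.
  exact: closed_le.
have [a a0 aA] := copositive_coercive.
pose L := \sum_i `|c 0 i|.
exists (Num.max 1 (L / a)); split; first exact: num_real.
move=> N; rewrite gt_max => /andP[N1 NL] x [xo /= fx].
have [x1|x1] := leP `|x| 1; first exact: le_trans x1 (ltW N1).
apply: le_trans (ltW NL); rewrite ler_pdivlMr// mulrC.
have x0 : 0 < `|x| := lt_trans ltr01 x1.
have : a * `|x| ^+ m * `|x| <= L * `|x|.
  rewrite -mulrA -exprSr; apply: le_trans (aA _ xo) _.
  apply: le_trans (ler_norm_dot c x).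
  rewrite -normrN; apply: le_trans (ler_norm _).
  by rewrite -subr_le0 opprK.
rewrite ler_pM2r//; apply: le_trans.
by rewrite ler_pM2l// ler_eXnr// ltW.
Qed.

Lemma compact_ncp_solutions q : (0 < m)%N -> compact (ncp_solutions q A).
Proof.
move=> m0; apply: subclosed_compact (compact_sublevel (c := q) m0) _.
  exact: closed_ncp_solutions.
by move=> x [xo _ /= x0]; split=> //=; rewrite /dot x0.
Qed.

Lemma ncp_solutions_nonempty q :
  (0 < m)%N -> symmetric_tensor A -> ncp_solutions q A !=set0.
Proof.
move=> m0 symA; pose c : 'rV[R]_n := m.+1%:R *: q.
have o0 : orthant (0 : 'rV[R]_n) by move=> i; rewrite mxE.
have f0 : tensor_form A 0 + dot c 0 = 0.
  by rewrite tensor_form0 add0r -(scale0r 0) dotZr mul0r.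
have [||x /set_mem[xo /= fx] x_min] := EVT_min_rV _
    (compact_sublevel (c := c) m0) (f := fun x => tensor_form A x + dot c x).
- by exists 0; split=> //=; rewrite f0.
- by apply: continuous_subspaceT; exact: continuous_objective.
(* outside of the sublevel set the objective is positive, hence larger *)
exists x; apply: minimizer_ncp_solution => // y yo.
have [fy|/ltW fy] := leP (tensor_form A y + dot c y) 0; last exact: le_trans fy.
by apply: x_min; apply/mem_set; split.
Qed.

End Coercivity.

(** * Uniqueness in the diagonalizable case *)

Lemma ltr_odd_exp (R : realDomainType) k (a b : R) :
  odd k -> a < b -> a ^+ k < b ^+ k.
Proof.
move=> kodd ab; have k0 : k != 0%N by case: k kodd.
have [a0|a0] := leP 0 a; first by rewrite ltrXn2r// (le_trans a0 (ltW ab)).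
have [b0|b0] := leP 0 b.
  by apply: (@lt_le_trans _ _ 0); rewrite ?exprn_odd_lt0 ?exprn_odd_ge0.
rewrite -ltrN2 -[- b ^+ k]mulN1r -[- a ^+ k]mulN1r.
rewrite -[-1](_ : (-1) ^+ k = -1); last by rewrite -signr_odd kodd.
by rewrite -!exprMn !mulN1r ltrXn2r ?ltrN2// oppr_ge0 ltW.
Qed.

Section Uniqueness.
Context (R : realType) (m n : nat) (A : tensor R m.+1 n).
Hypothesis m_odd : odd m.
Implicit Types (q x y v : 'rV[R]_n).

Lemma diagonalizable_dot_tensor_map (D : tensor R m.+1 n) (B : 'M[R]_n) v x :
  diagonal_tensor D -> A = mode_product_all D B ->
  dot v (tensor_map A x)
  = \sum_(j < n) D [ffun=> j] * ((v *m B) 0 j * (x *m B) 0 j ^+ m).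
Proof.
move=> diagD ->; rewrite -multilinear_form_slot0.
rewrite multilinear_form_mode_product_all multilinear_form_diagonal//.
apply: eq_bigr => j _; congr (_ * _); rewrite big_ord_recl eqxx; congr (_ * _).
by rewrite (eq_bigr (fun=> (x *m B) 0 j))// prodr_const card_ord.
Qed.

Lemma diagonalizable_strict_monotone x y :
  diagonalizable_tensor A -> positive_definite A -> x != y ->
  0 < dot (x - y) (tensor_map A x - tensor_map A y).
Proof.
move=> [D [B [diagD detB AE]]] posA xy.
have Bu : B \in unitmx by rewrite unitmxE unitfE.
have dotE := diagonalizable_dot_tensor_map _ _ diagD AE.
(* the form of A takes the value D_(j...j) at the vector sent to e_j by B *)
have D0 j : 0 < D [ffun=> j].
  pose e : 'rV[R]_n := delta_mx 0 j *m invmx B.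
  have eB : e *m B = delta_mx 0 j by rewrite mulmxKV.
  have e0 : e != 0.
    apply: contraTneq (@oner_neq0 R) => e0; rewrite negbK.
    have := congr1 (fun M : 'rV[R]_n => M 0 j) eB.
    by rewrite e0 mul0mx !mxE !eqxx => /esym/eqP.
  have := posA e e0; rewrite -dot_tensor_map dotE eB (bigD1 j)//= big1 => [|i ij].
    by rewrite !mxE !eqxx expr1n mulr1 mulr1 addr0.
  by rewrite !mxE (negPf ij) andbF mul0r mulr0.
rewrite dotDr dotNr !dotE -sumrB.
have BE j : ((x - y) *m B) 0 j = (x *m B) 0 j - (y *m B) 0 j.
  by rewrite mulmxBl mxE; congr (_ + _); rewrite mxE.
under eq_bigr do rewrite -mulrBr -mulrBr BE.
have gap (a b : R) : a != b -> 0 < (a - b) * (a ^+ m - b ^+ m).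
  case: (ltgtP a b) => // ab _.
    by rewrite nmulr_lgt0 subr_lt0// ltr_odd_exp.
  by rewrite pmulr_lgt0 subr_gt0// ltr_odd_exp.
have [j xyj] : exists j, (x *m B) 0 j != (y *m B) 0 j.
  apply/existsP; apply: contraNT xy => /existsPn nxy.
  apply/eqP; apply: (can_inj (mulmxK Bu)); apply/rowP => j.
  exact/eqP/negPn/nxy.
rewrite (bigD1 j)//=; apply: ltr_pwDl; first by rewrite mulr_gt0// gap.
apply: sumr_ge0 => i _; apply: mulr_ge0; first exact: ltW.
have [->|/gap/ltW//] := eqVneq ((x *m B) 0 i) ((y *m B) 0 i).
by rewrite subrr mul0r.
Qed.

Lemma ncp_solution_unique q x y :
  (forall x y, x != y ->
     0 < dot (x - y) (tensor_map A x - tensor_map A y)) ->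
  ncp_solutions q A x -> ncp_solutions q A y -> x = y.
Proof.
move=> monoA [xo Fxo Fx] [yo Fyo Fy].
rewrite -/(dot q x) (dotC q) -dot_tensor_map -dotDr in Fx.
rewrite -/(dot q y) (dotC q) -dot_tensor_map -dotDr in Fy.
apply/eqP/negPn/negP => /monoA; apply/negP; rewrite -leNgt.
have -> : tensor_map A x - tensor_map A y
    = (tensor_map A x + q) - (tensor_map A y + q).
  by rewrite opprD addrACA subrr addr0.
rewrite dotDr dotNr ![dot (x - y) _]dotC !(dotDr _ x) !(dotNr _ y).
rewrite ![dot _ x]dotC ![dot _ y]dotC Fx Fy add0r subr0 -opprD oppr_le0.
by rewrite addr_ge0 ?dot_ge0.
Qed.

End Uniqueness.

(** * Solvability, compactness and uniqueness *)

Theorem theorem5 (R : realType) (m n : nat) (A : tensor R m n) (q : 'rV[R]_n)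
    (hm : (2 <= m)%N) (hn : (2 <= n)%N) (m_even : ~~ odd m)
    (A_sym : symmetric_tensor A) (q_neq0 : q != 0) :
  [/\ diagonalizable_tensor A -> positive_definite A ->
        exists! x : 'rV[R]_n, ncp_solutions q A x,
      positive_definite A ->
        ncp_solutions q A !=set0 /\ compact (ncp_solutions q A)
    & strictly_copositive A ->
        ncp_solutions q A !=set0 /\ compact (ncp_solutions q A)].
Proof.
case: m A hm m_even A_sym => // m A m0 m_odd symA.
rewrite ltnS in m0; rewrite /= negbK in m_odd.
have copositive_case : strictly_copositive A ->
    ncp_solutions q A !=set0 /\ compact (ncp_solutions q A).
  move=> copA; split; first exact: ncp_solutions_nonempty.
  exact: compact_ncp_solutions.
have pos_cop : positive_definite A -> strictly_copositive A.
  by move=> posA x _; exact: posA.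
split=> // [diagA posA|/pos_cop//].
have [[x xsol] _] := copositive_case (pos_cop posA).
exists x; split=> // y; apply: ncp_solution_unique xsol => u v uv.
exact: diagonalizable_strict_monotone.
Qed.
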